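(* Let $K>0$ be a Lipschitz constant of the gradient of $f$ on the sublevel set $F^{-1}(-\infty,\beta]$. For a sufficiently large penalty parameter $\rho$ (i.e. there is $\rho_0>0$ such that for every $\rho>\rho_0$) and any step size $\gamma>0$ with $\gamma\le\frac1{K+2\rho}$, the following holds for the sequence $\{A^k\}$, $A^k=(L^k,S^k,U^k,V^k;\Lambda^k,\Theta^k)$, generated by the $\ell_0$ ADMM algorithm: if the sequence of dual variables $\{(\Lambda^k,\Theta^k)\}$ is bounded, then $\{A^k\}$ is bounded.
   Context: Fix a positive integer $p$, real $C>0$, $\mu>0$, and a symmetric positive definite $\check\Sigma\in\mathbb R^{p\times p}$. All matrices are real symmetric $p\times p$; $\|\cdot\|_{\mathrm F}$ is the Frobenius norm; $\|S\|_0$ is the number of nonzero entries of $S$; $\langle A,B\rangle=\operatorname{tr}(AB^\top)$. Let $\mathscr D=\{(L,S):L\succeq0,\ S\succeq0,\ L+S\succ0\}$, $$f(L,S)=\operatorname{tr}(L)+\mu\{\operatorname{tr}[(L+S)\check\Sigma^{-1}]-\log\det(L+S)\},\qquad F(L,S)=f(L,S)+C\|S\|_0,$$ where the log-determinant implicitly enforces $L+S\succ0$ ($f=+\infty$ otherwise). Fix a feasible point $(\bar L,\bar S)\in\mathscr D$, set $\beta=F(\bar L,\bar S)$ and $F^{-1}(-\infty,\beta]=\{(L,S)\in\mathscr D:F(L,S)\le\beta\}$. The $\ell_0$ ADMM with penalty parameter $\rho>0$ and step size $\gamma>0$. Let $\Pi_+$ be the orthogonal projection of symmetric matrices onto the cone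 of positive semidefinite matrices. Let $\operatorname{prox}_{\gamma C\|\cdot\|_0}(T)$ be the matrix with $(i,j)$ entry $0$ if $|t_{ij}|\le\sqrt{2\gamma C}$ and $t_{ij}$ otherwise. Initialization: with spectral decomposition $\check\Sigma=QJQ^\top$, $J=\operatorname{diag}(\tau_1,\dots,\tau_p)$, $\tau_1\ge\dots\ge\tau_p$, and some $d<p$, put $L^0=Q\operatorname{diag}(\tau_1,\dots,\tau_d,0,\dots,0)Q^\top$, $S^0=\check\Sigma-L^0$, $U^0=L^0$, $V^0=S^0$, $\Lambda^0=\Theta^0=0$. Iteration for $k\ge0$: - $L^{k+1}=\operatorname{argmin}_{L}\ f(L,S^k)-\langle\Lambda^k,L\rangle+\frac\rho2\|L-U^k\|_{\mathrm F}^2$, i.e. $L^{k+1}=\frac{\mu}{2\rho}X^k\big(\sqrt{(D^k)^2+\frac{4\rho}{\mu}I}-D^k\big)(X^k)^\top-S^k$, where $X^kD^k(X^k)^\top$ is the spectral decomposition of $\frac1\mu\big(I-\Lambda^k+\mu\check\Sigma^{-1}-\rho(S^k+U^k)\big)$; - $S^{k+1}=\operatorname{prox}_{\gamma C\|\cdot\|_0}\big[S^k-\gamma(\nabla_Sf(L^{k+1},S^k)-\Theta^k+\rho(S^k-V^k))\big]$; - $U^{k+1}=\Pi_+(L^{k+1}-\frac1\rho\Lambda^k)$; - $V^{k+1}=\Pi_+(S^{k+1}-\frac1\rho\Theta^k)$; - $\Lambda^{k+1}=\Lambda^k-\rho(L^{k+1}-U^{k+1})$; - $\Theta^{k+1}=\Theta^k-\rho(S^{k+1}-V^{k+1})$.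 *)

(* Defs.v *)
From HB Require Import structures.
From mathcomp Require Import all_boot all_order all_algebra.
From mathcomp Require Import boolp classical_sets reals ereal exp.

Set Implicit Arguments.
Unset Strict Implicit.
Unset Printing Implicit Defensive.

Import Order.TTheory GRing.Theory Num.Theory.

Local Open Scope classical_set_scope.
Local Open Scope ring_scope.

Section MatrixNotions.
Context {R : realType} {p : nat}.
Implicit Types A B L S T : 'M[R]_p.

Definition symmetric A : Prop := A^T = A.

Definition psd A : Prop :=
  symmetric A /\ forall x : 'cV[R]_p, 0 <= (x^T *m A *m x) 0 0.

Definition posdef A : Prop :=
  symmetric A /\ forall x : 'cV[R]_p, x != 0 -> 0 < (x^T *m A *m x) 0 0.

Definition inner A B : R := \tr (A *m B^T).

Definition normF A : R := Num.sqrt (inner A A).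

Definition normF2 A B : R := Num.sqrt (normF A ^+ 2 + normF B ^+ 2).

Definition norm0 A : nat := #|[set ij : 'I_p * 'I_p | A ij.1 ij.2 != 0]%SET|.

Definition bounded_seq (X : nat -> 'M[R]_p) : Prop :=
  exists c : R, forall k, normF (X k) <= c.

End MatrixNotions.

Definition is_argmin {T : Type} {R : realType} (D : set T) (g : T -> \bar R)
    (x : T) : Prop :=
  D x /\ forall y, D y -> (g x <= g y)%E.

(* Fréchet gradient of [h] at [(L, S)], in the space of pairs of symmetric
   matrices with the Frobenius inner product.  As [+oo - +oo = -oo] in [\bar R]
   and every infinite value makes the left-hand side [+oo], the estimate also
   forces [h] to be finite near [(L, S)]. *)
Definition is_gradient {R : realType} {p : nat}
    (h : 'M[R]_p -> 'M[R]_p -> \bar R) (L S GL GS : 'M[R]_p) : Prop :=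
  [/\ symmetric GL, symmetric GS &
    forall e : R, 0 < e -> exists2 delta : R, 0 < delta &
      forall HL HS : 'M[R]_p, symmetric HL -> symmetric HS ->
        normF2 HL HS <= delta ->
        (`| h (L + HL)%R (S + HS)%R - h L S - (inner GL HL + inner GS HS)%:E |
           <= (e * normF2 HL HS)%:E)%E].

Section Model.
Context {R : realType} {p : nat}.
Variables (C mu : R) (Sigma : 'M[R]_p).

Definition domD (L S : 'M[R]_p) : Prop := [/\ psd L, psd S & posdef (L + S)].

Definition objf (L S : 'M[R]_p) : \bar R :=
  if `[< posdef (L + S) >] then
    (\tr L + mu * (\tr ((L + S) *m invmx Sigma) - ln (\det (L + S))))%:E
  else +oo%E.

Definition objF (L S : 'M[R]_p) : \bar R :=
  (objf L S + (C * (norm0 S)%:R)%:E)%E.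

Definition sublevel (beta : \bar R) : set ('M[R]_p * 'M[R]_p) :=
  [set X | domD X.1 X.2 /\ (objF X.1 X.2 <= beta)%E].

Definition grad_lipschitz_on (E : set ('M[R]_p * 'M[R]_p)) (K : R) : Prop :=
  forall L S L' S' GL GS GL' GS' : 'M[R]_p,
    E (L, S) -> E (L', S') ->
    is_gradient objf L S GL GS -> is_gradient objf L' S' GL' GS' ->
    normF2 (GL - GL') (GS - GS') <= K * normF2 (L - L') (S - S').

Definition is_psd_proj (T P : 'M[R]_p) : Prop :=
  is_argmin [set Z | psd Z] (fun Z => (normF (T - Z))%:E) P.

Definition prox_l0 (gamma : R) (T : 'M[R]_p) : 'M[R]_p :=
  \matrix_(i, j) if `|T i j| <= Num.sqrt (2 * gamma * C) then 0 else T i j.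

Record admm_state := AdmmState {
  itL : 'M[R]_p; itS : 'M[R]_p; itU : 'M[R]_p; itV : 'M[R]_p;
  itLambda : 'M[R]_p; itTheta : 'M[R]_p }.

Definition admm_init (A0 : admm_state) : Prop :=
  exists (Q : 'M[R]_p) (tau : 'rV[R]_p) (d : nat),
    [/\ Q *m Q^T = 1%:M /\ Sigma = Q *m diag_mx tau *m Q^T,
        (forall i j : 'I_p, (i <= j)%N -> tau 0 j <= tau 0 i),
        (d < p)%N,
        itL A0 = Q *m diag_mx (\row_j if (j < d)%N then tau 0 j else 0) *m Q^T /\
        itS A0 = Sigma - itL A0 &
        [/\ itU A0 = itL A0, itV A0 = itS A0, itLambda A0 = 0 & itTheta A0 = 0]].

Definition admm_step (rho gamma : R) (A A' : admm_state) : Prop :=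
  [/\ is_argmin [set L | symmetric L]
        (fun L => objf L (itS A) - (inner (itLambda A) L)%:E
                  + (rho / 2 * normF (L - itU A) ^+ 2)%:E)%E (itL A'),
      exists2 GL_GS : 'M[R]_p * 'M[R]_p,
        is_gradient objf (itL A') (itS A) GL_GS.1 GL_GS.2 &
        itS A' = prox_l0 gamma
          (itS A - gamma *: (GL_GS.2 - itTheta A + rho *: (itS A - itV A))),
      is_psd_proj (itL A' - rho^-1 *: itLambda A) (itU A') /\
      is_psd_proj (itS A' - rho^-1 *: itTheta A) (itV A'),
      itLambda A' = itLambda A - rho *: (itL A' - itU A') &
      itTheta A' = itTheta A - rho *: (itS A' - itV A')].

Definition is_admm_sequence (rho gamma : R) (A : nat -> admm_state) : Prop :=
  admm_init (A 0%N) /\ forall k, admm_step rho gamma (A k) (A k.+1).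

Definition dual_bounded (A : nat -> admm_state) : Prop :=
  bounded_seq (fun k => itLambda (A k)) /\
  bounded_seq (fun k => itTheta (A k)).

Definition admm_bounded (A : nat -> admm_state) : Prop :=
  [/\ bounded_seq (fun k => itL (A k)), bounded_seq (fun k => itS (A k)),
      bounded_seq (fun k => itU (A k)), bounded_seq (fun k => itV (A k)) &
      dual_bounded A].

End Model.

Arguments admm_state R p : clear implicits.

(* Main.v *)
Require Import Defs.
From HB Require Import structures.
From mathcomp Require Import all_boot all_order all_algebra.
From mathcomp Require Import boolp classical_sets reals ereal sequences exp.
From mathcomp Require Import ring lra.

(** Write [W = L' + S] and [M = W^-1], where primes denote the next iterate.  By
    the Moreau decomposition the dual iterates lie in the dual of the psd cone
    and are orthogonal to [U'] and [V'], while [L' - U'] and [S' - V'] are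
    bounded with the dual iterates.
    Pairing the optimality condition of the [L]-step with [M] bounds [M],
    because [rho W - mu M] is a psd matrix up to a bounded error.  Hence [<M, U'>] and
    [<M, V>] are bounded, both being at most [<M, W> = p] up to a bounded error.
    Pairing the same condition with [U'] gives
    [rho <U' - U, U'> <= mu <M, U'> - <I + mu Sigma^-1, U'>], and the last
    term is coercive on the psd cone, so [|U'| <= max(|U|, r)].
    Hard thresholding does not increase the norm, so [S'] is dominated by a
    gradient step along [N] with [<S, N> >= a |S| - const], [a > 0], which gives
    [|S'| <= max(|S|, r)].  *)

Set Implicit Arguments.
Unset Strict Implicit.
Unset Printing Implicit Defensive.

Import Order.TTheory GRing.Theory Num.Theory.

Local Open Scope ring_scope.

(** * Cauchy-Schwarz and the Frobenius inner product *)

Lemma sum_cauchy_schwarz (R : realFieldType) (I : finType) (x y : I -> R) :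
  (\sum_i x i * y i) ^+ 2 <= (\sum_i x i ^+ 2) * (\sum_i y i ^+ 2).
Proof.
set a := \sum_i x i ^+ 2; set b := \sum_i y i ^+ 2; set c := \sum_i _.
have b_ge0 : 0 <= b by apply: sumr_ge0 => i _; exact: sqr_ge0.
have [b0|b_neq0] := eqVneq b 0.
  have y0 i : y i = 0.
    apply/eqP; rewrite -sqrf_eq0.
    by rewrite (psumr_eq0P _ b0) // => j _; exact: sqr_ge0.
  by rewrite /c big1 ?expr0n /= ?b0 ?mulr0 // => i _; rewrite y0 mulr0.
have b_gt0 : 0 < b by rewrite lt_def b_neq0.
(* Expanding this sum of squares yields [b] times [a * b - c ^+ 2], and the positive [b] can be
   divided out. *)
have : 0 <= \sum_i (b * x i - c * y i) ^+ 2.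
  by apply: sumr_ge0 => i _; exact: sqr_ge0.
have sqrE i : (b * x i - c * y i) ^+ 2 =
    b ^+ 2 * x i ^+ 2 + (- 2 * b * c) * (x i * y i) + c ^+ 2 * y i ^+ 2 by ring.
rewrite (eq_bigr _ (fun i _ => sqrE i)) !big_split /= -!mulr_sumr -/a -/b -/c.
have -> : b ^+ 2 * a + - 2 * b * c * c + c ^+ 2 * b = b * (a * b - c ^+ 2).
  by ring.
by rewrite pmulr_rge0 // subr_ge0.
Qed.

Section Frobenius.
Context {R : realType} {p : nat}.
Implicit Types (A B G H M V : 'M[R]_p).

Lemma innerE A B : inner A B = \sum_i \sum_j A i j * B i j.
Proof.
by apply: eq_bigr => i _; rewrite mxE; apply: eq_bigr => j _; rewrite mxE.
Qed.

Lemma innerC A B : inner A B = inner B A.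
Proof. by rewrite /inner -mxtrace_tr trmx_mul trmxK. Qed.

Lemma innerDl A B G : inner (A + B) G = inner A G + inner B G.
Proof. by rewrite /inner mulmxDl mxtraceD. Qed.

Lemma innerZl a A B : inner (a *: A) B = a * inner A B.
Proof. by rewrite /inner -scalemxAl mxtraceZ. Qed.

Lemma innerNl A B : inner (- A) B = - inner A B.
Proof. by rewrite -scaleN1r innerZl mulN1r. Qed.

Lemma innerDr A B G : inner A (B + G) = inner A B + inner A G.
Proof. by rewrite !(innerC A) innerDl. Qed.

Lemma innerZr a A B : inner A (a *: B) = a * inner A B.
Proof. by rewrite !(innerC A) innerZl. Qed.

Lemma innerNr A B : inner A (- B) = - inner A B.
Proof. by rewrite !(innerC A) innerNl. Qed.

Lemma inner0l A : inner 0 A = 0.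
Proof. by rewrite /inner mul0mx mxtrace0. Qed.

Lemma inner0r A : inner A 0 = 0.
Proof. by rewrite innerC inner0l. Qed.

Definition inner_linE := (innerDl, innerDr, innerNl, innerNr, innerZl, innerZr).

Lemma innerAA A : inner A A = \sum_ij A ij.1 ij.2 ^+ 2.
Proof. by rewrite innerE pair_bigA. Qed.

Lemma inner_ge0 A : 0 <= inner A A.
Proof. by rewrite innerAA sumr_ge0 // => ij _; exact: sqr_ge0. Qed.

Lemma inner_eq0 A : inner A A = 0 -> A = 0.
Proof.
rewrite innerAA => A0; apply/matrixP => i j; rewrite mxE.
apply/eqP; rewrite -sqrf_eq0.
have /psumr_eq0P/(_ A0 (i, j) isT)/= -> // :
  forall ij, predT ij -> 0 <= A ij.1 ij.2 ^+ 2 by move=> ij _; exact: sqr_ge0.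
Qed.

Lemma normF_ge0 A : 0 <= normF A. Proof. exact: sqrtr_ge0. Qed.

Lemma normF_sqr A : normF A ^+ 2 = inner A A.
Proof. by rewrite sqr_sqrtr // inner_ge0. Qed.

Lemma normFZ a A : normF (a *: A) = `|a| * normF A.
Proof.
by rewrite /normF !inner_linE mulrA -expr2 sqrtrM ?sqr_ge0 // sqrtr_sqr.
Qed.

Lemma normFN A : normF (- A) = normF A.
Proof. by rewrite -scaleN1r normFZ normrN1 mul1r. Qed.

Lemma inner_le A B : inner A B <= normF A * normF B.
Proof.
rewrite (le_trans (ler_norm _)) // -ler_sqr ?nnegrE ?mulr_ge0 ?normF_ge0 //.
rewrite exprMn !normF_sqr !innerAA real_normK ?num_real // innerE pair_bigA.
exact: sum_cauchy_schwarz.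
Qed.

Lemma inner_ge A B : - (normF A * normF B) <= inner A B.
Proof. by rewrite lerNl -innerNl -(normFN A) inner_le. Qed.

Lemma normFD A B : normF (A + B) <= normF A + normF B.
Proof.
rewrite -ler_sqr ?nnegrE ?addr_ge0 ?normF_ge0 // normF_sqr !inner_linE.
by rewrite -!normF_sqr (innerC B); have := inner_le A B; nra.
Qed.

Lemma normFB A B : normF (A - B) <= normF A + normF B.
Proof. by rewrite (le_trans (normFD _ _)) // normFN. Qed.

Lemma normF_le_entries A B :
  (forall i j, `|A i j| <= `|B i j|) -> normF A <= normF B.
Proof.
move=> leAB; rewrite ler_sqrt ?inner_ge0 // !innerAA.
apply: ler_sum => ij _.
by rewrite -real_normK ?num_real // -(real_normK (num_real (B _ _)));
  rewrite ler_sqr ?nnegrE.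
Qed.

Lemma normF_tr A : normF A^T = normF A.
Proof. by rewrite /normF /inner trmxK mxtrace_mulC. Qed.

(** Each entry of the product pairs a row of [A] with a column of [B], so Cauchy-Schwarz applies
    entrywise; transposing [B] turns its columns into rows, and the double sum factors. *)
Lemma normFM A B : normF (A *m B) <= normF A * normF B.
Proof.
rewrite -ler_sqr ?nnegrE ?mulr_ge0 ?normF_ge0 // exprMn -(normF_tr B).
rewrite !normF_sqr !innerE mulr_suml; apply: ler_sum => i _.
rewrite mulr_sumr; apply: ler_sum => j _.
rewrite !mxE -expr2; under [X in _ * X]eq_bigr do rewrite mxE -expr2.
exact: sum_cauchy_schwarz.
Qed.

End Frobenius.

(** * Cholesky factorization of psd matrices *)

Lemma mulmx_tr_eq0 (R : realFieldType) n (b : 'cV[R]_n) :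
  (b^T *m b) 0 0 = 0 -> b = 0.
Proof.
rewrite mxE => b0; apply/colP => i; rewrite mxE; apply/eqP.
rewrite -sqrf_eq0 expr2; apply/eqP.
have := @psumr_eq0P _ _ predT (fun j => b^T 0 j * b j 0) _ b0 i isT.
by rewrite mxE; apply=> j _; rewrite mxE -expr2 sqr_ge0.
Qed.

(** Induction on the size, eliminating the first row and column. The factors turn pairings of psd
    matrices into squared norms, and triangularity lets the determinant be read off the diagonal. *)
Lemma psd_cholesky (R : realType) n (A : 'M[R]_n) :
  psd A -> exists2 G : 'M[R]_n, is_trig_mx G & A = G *m G^T.
Proof.
elim: n A => [|n IHn] A; first by exists 0;
  [exact: mx0_is_trig | apply/matrixP; case].
rewrite -[n.+1]/(1 + n)%N in A *; move=> [symA A_ge0].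
pose a := A 0 0; pose b : 'cV[R]_n := dlsubmx A; pose D := drsubmx A.
have ulA : ulsubmx A = a%:M.
  by rewrite [LHS]mx11_scalar !mxE; congr (A _ _)%:M; exact/val_inj.
have urA : ursubmx A = b^T by rewrite /b -[in RHS]symA trmx_dlsub trmxK.
have defA : A = block_mx a%:M b^T b D by rewrite -ulA -urA submxK.
have symD : D^T = D by rewrite /D trmx_drsub symA.
(* This is the quadratic form of [A] at the column with head [s] and tail [y]. *)
have formA s (y : 'cV_n) :
    0 <= s ^+ 2 * a + 2 * s * (b^T *m y) 0 0 + (y^T *m D *m y) 0 0.
  have := A_ge0 (col_mx (s%:M : 'M_1) y); rewrite defA tr_col_mx mul_row_block.
  rewrite mul_row_col tr_scalar_mx !mulmxDl !mul_mx_scalar !mul_scalar_mx.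
  have -> : y^T *m b = b^T *m y.
    by rewrite [RHS]mx11_scalar -tr_scalar_mx -mx11_scalar trmx_mul trmxK.
  rewrite -!scalemxAl !mxE /= mulr1n.
  by set u := \sum_(j < n) _; set v := \sum_(j < n) _; nra.
have a_ge0 : 0 <= a.
  by have := formA 1 0; rewrite !mulmx0 !mxE; lra.
pose r := Num.sqrt a.
pose c : 'cV_n := r^-1 *: b.
have rr : r ^+ 2 = a by rewrite sqr_sqrtr.
have b0 : r = 0 -> b = 0.
  move=> r0; have a0 : a = 0 by rewrite -rr r0 expr0n.
  apply: mulmx_tr_eq0; apply/eqP/negPn/negP; set u := _ 0 0 => u_neq0.
  (* With a zero pivot the form is affine in its head; this head gives it the value -1,
     contradicting nonnegativity. *)
  have := formA (- ((b^T *m D *m b) 0 0 + 1) / (2 * u)) b.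
  rewrite a0 -/u; set v := (b^T *m D *m b) 0 0; rewrite mulr0 add0r.
  have -> : 2 * (- (v + 1) / (2 * u)) * u = - (v + 1) by field.
  by lra.
have rc : r *: c = b.
  rewrite /c scalerA; have [r0|r_neq0] := eqVneq r 0.
    by rewrite b0 // scaler0.
  by rewrite divff // scale1r.
have c0 : r = 0 -> c = 0 by move=> /b0 b0'; rewrite /c b0' scaler0.
clearbody c.
(* Such an [s] completes the square, so the form of [A] reduces to that of the Schur complement at
   [y]. If [r] is zero then so is [c], and [s = 0] is admissible. *)
have cb s (y : 'cV_n) : r * s = - (c^T *m y) 0 0 ->
    (y^T *m (D - c *m c^T) *m y) 0 0 =
    s ^+ 2 * a + 2 * s * (b^T *m y) 0 0 + (y^T *m D *m y) 0 0.
  rewrite -rc [(r *: c)^T]linearZ /= -scalemxAl mulmxBr mulmxBl => rs.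
  have -> : y^T *m (c *m c^T) *m y = (c^T *m y)^T *m (c^T *m y).
    by rewrite trmx_mul trmxK !mulmxA.
  move: (c^T *m y) (y^T *m D *m y) rs => w q rs; rewrite -rr !mxE big_ord1 !mxE.
  have -> : w 0 0 = - (r * s) by rewrite rs opprK.
  by ring.
(* Schur complement; the convention 0^-1 = 0 covers a vanishing pivot [a]. *)
have [|G trigG defG] := IHn (D - c *m c^T).
  split=> [|y].
    by rewrite /Defs.symmetric [LHS]linearB /= trmx_mul trmxK symD.
  have [r0|r_neq0] := eqVneq r 0.
    rewrite (cb 0); first exact: formA.
    by rewrite mulr0 c0 // trmx0 mul0mx mxE oppr0.
  rewrite (cb (- (c^T *m y) 0 0 / r)); first exact: formA.
  by field.
exists (block_mx r%:M 0 c G).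
  by rewrite is_trig_block_mx // eqxx scalar_mx_is_trig.
rewrite tr_block_mx mulmx_block trmx0 !mulmx0 !mul0mx !addr0 tr_scalar_mx.
by rewrite -scalar_mxM -expr2 rr mul_scalar_mx mul_mx_scalar -linearZ /= rc
  -defG addrC subrK -defA.
Qed.

(** * Positive matrices: trace pairings and the log-determinant *)

Section PositiveMatrices.
Context {R : realType} {p : nat}.
Implicit Types (A B G H M V W X : 'M[R]_p).

Lemma posdef_psd A : posdef A -> psd A.
Proof.
case=> symA A_gt0; split=> // x; have [->|x0] := eqVneq x 0.
  by rewrite mulmx0 mxE.
exact/ltW/A_gt0.
Qed.

Lemma posdef1 : posdef (1%:M : 'M[R]_p).
Proof.
split=> [|x x_neq0]; first exact: trmx1.
rewrite mulmx1 lt_def; apply/andP; split.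
  by apply: contra x_neq0 => /eqP/mulmx_tr_eq0 ->.
by rewrite mxE sumr_ge0 // => j _; rewrite mxE -expr2 sqr_ge0.
Qed.

Lemma posdefD A B : posdef A -> psd B -> posdef (A + B).
Proof.
move=> [sA pA] [sB pB]; split=> [|x x0].
  by rewrite /Defs.symmetric linearD /= sA sB.
by rewrite mulmxDr mulmxDl mxE ltr_wpDr ?pA ?pB.
Qed.

Lemma psdD A B : psd A -> psd B -> psd (A + B).
Proof.
move=> [sA pA] [sB pB]; split=> [|x].
  by rewrite /Defs.symmetric linearD /= sA sB.
by rewrite mulmxDr mulmxDl mxE addr_ge0.
Qed.

Lemma psdZ a A : 0 <= a -> psd A -> psd (a *: A).
Proof.
move=> a0 [sA pA]; split=> [|x]; first by rewrite /Defs.symmetric linearZ /= sA.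
by rewrite -scalemxAr -scalemxAl mxE mulr_ge0.
Qed.

Lemma posdef_unitmx A : posdef A -> A \in unitmx.
Proof.
move=> [symA A_gt0]; rewrite -row_free_unit -kermx_eq0.
apply/negPn/negP => /rowV0Pn[x /sub_kermxP xA x_neq0].
have := A_gt0 x^T; rewrite trmxK xA mul0mx mxE ltxx => /(_ _)/negP; apply=> //.
by apply: contra x_neq0 => /eqP x0; rewrite -[x]trmxK x0 trmx0.
Qed.

Lemma posdef_congr G A : posdef A -> G \in unitmx -> posdef (G^T *m A *m G).
Proof.
move=> [symA A_gt0] uG; split=> [|x x_neq0].
  by rewrite /Defs.symmetric !trmx_mul trmxK symA mulmxA.
have := A_gt0 (G *m x); rewrite trmx_mul !mulmxA; apply.
apply: contra x_neq0 => /eqP Gx0.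
by rewrite -[x]mul1mx -(mulVmx uG) -mulmxA Gx0 mulmx0.
Qed.

Lemma posdef_invmx A : posdef A -> posdef (invmx A).
Proof.
move=> pdA; have uA := posdef_unitmx pdA.
have := posdef_congr pdA (_ : invmx A \in unitmx).
rewrite unitmx_inv uA => /(_ isT).
by rewrite trmx_inv pdA.1 mulVmx // mul1mx.
Qed.

Lemma posdef_cholesky A : posdef A ->
  exists G, [/\ is_trig_mx G, G \in unitmx & A = G *m G^T].
Proof.
move=> pdA; have [G trigG defA] := psd_cholesky (posdef_psd pdA).
exists G; split=> //.
by have := posdef_unitmx pdA; rewrite defA unitmx_mul unitmx_tr andbb.
Qed.

(** Once both matrices are factored, cyclicity of the trace turns the pairing into the squared norm
    of [G^T *m H]. *)
Lemma inner_psd_ge0 A B : psd A -> psd B -> 0 <= inner A B.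
Proof.
move=> /psd_cholesky[G _ ->] /psd_cholesky[H _ ->].
suff -> : inner (G *m G^T) (H *m H^T) = inner (G^T *m H) (G^T *m H).
  exact: inner_ge0.
rewrite /inner !trmx_mul !trmxK -!mulmxA mxtrace_mulC.
by rewrite !mulmxA.
Qed.

(** With [M = G *m G^T] and [V = H *m H^T], the pairing is the squared norm of [G^T *m H]. The norm
    of [V] is at most the squared norm of [H], and [H] is recovered through the inverse of [G^T].
    This coercivity drives both iterate bounds. *)
Lemma psd_normF_le_inner M : posdef M ->
  exists2 c : R, 0 < c & forall V, psd V -> c * normF V <= inner M V.
Proof.
move=> /posdef_cholesky[G [_ uG ->]].
(* The added 1 keeps [d] positive, hence invertible. *)
pose d := normF (invmx G^T) ^+ 2 + 1.
have d_gt0 : 0 < d by rewrite ltr_wpDl ?sqr_ge0.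
exists d^-1; rewrite ?invr_gt0 // => _ /psd_cholesky[H _ ->].
rewrite ler_pdivrMl //.
have -> : inner (G *m G^T) (H *m H^T) = normF (G^T *m H) ^+ 2.
  rewrite normF_sqr /inner !trmx_mul !trmxK -!mulmxA mxtrace_mulC.
  by rewrite !mulmxA.
have := normFM (invmx G^T) (G^T *m H); rewrite mulKmx ?unitmx_tr //.
have := normFM H H^T; rewrite normF_tr.
have := normF_ge0 H; have := normF_ge0 (invmx G^T).
have := normF_ge0 (G^T *m H); rewrite /d.
set x := normF _; set y := normF _; set z := normF H; set t := normF _.
move=> x0 y0 z0 tz zxy; apply: (le_trans tz).
have : z * z <= (y * x) * (y * x) by rewrite ler_pM.
by nra.
Qed.

Lemma posdef_det_gt0 A : posdef A -> 0 < \det A.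
Proof.
move=> pdA; have [G [_ uG ->]] := posdef_cholesky pdA.
rewrite det_mulmx det_tr -expr2 lt_def sqr_ge0 andbT sqrf_eq0.
by rewrite -unitfE -unitmxE.
Qed.

(** The inequality [1 + x <= expR x] is applied at each squared diagonal entry of the Cholesky
    factor, minus 1: the product of these squares is the determinant, while the trace sums the
    squares of all entries. *)
Lemma ln_det_le X : posdef X -> ln (\det X) <= \tr X - p%:R.
Proof.
move=> pdX; rewrite -[leRHS]expRK ler_ln ?posrE ?expR_gt0 ?posdef_det_gt0 //.
have [G [trigG _ ->]] := posdef_cholesky pdX.
rewrite det_mulmx det_tr det_trig // -big_split /=.
apply: (@le_trans _ _ (\prod_(i < p) expR (G i i * G i i - 1))).
  apply: ler_prod => i _; rewrite -expr2 sqr_ge0 /=.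
  by rewrite (le_trans _ (expR_ge1Dx _)) // addrC subrK.
rewrite -expR_sum ler_expR sumrB sumr_const card_ord lerD2r.
rewrite -/(inner G G) innerE; apply: ler_sum => i _.
rewrite (bigD1 i) //= lerDl sumr_ge0 // => j _.
by rewrite -expr2 sqr_ge0.
Qed.

Lemma inner_invmx W : posdef W -> inner (invmx W) W = p%:R.
Proof.
by move=> pdW; rewrite /inner pdW.1 mulVmx ?mxtrace1 // posdef_unitmx.
Qed.

(** This tangent inequality is [ln_det_le] at [G^T *m X *m G], where [invmx W = G *m G^T]: the
    determinant there is [\det X / \det W] and the trace is the pairing of [invmx W] with [X]. *)
Lemma ln_det_concave W X : posdef W -> posdef X ->
  ln (\det X) - ln (\det W) <= inner (invmx W) (X - W).
Proof.
move=> pdW pdX; have pdM := posdef_invmx pdW.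
have [G [_ uG defM]] := posdef_cholesky pdM.
have pdY := posdef_congr pdX uG.
have [detW detY] := (posdef_det_gt0 pdW, posdef_det_gt0 pdY).
have detE : \det X = \det W * \det (G^T *m X *m G).
  have : \det W * \det (G *m G^T) = 1.
    by rewrite -defM -det_mulmx mulmxV ?det1 // posdef_unitmx.
  by rewrite !det_mulmx => GW; rewrite -[LHS]mulr1 -GW; ring.
rewrite detE lnM ?posrE // addrC addKr (le_trans (ln_det_le pdY)) //.
rewrite innerDr innerNr inner_invmx // /inner pdX.1 defM.
by rewrite mxtrace_mulC mulmxA.
Qed.

End PositiveMatrices.

(** * First-order conditions: projections, gradients and minimizers *)

Lemma ge0_of_eps (R : realFieldType) (x q : R) :
  (forall e : R, 0 < e -> e <= 1 -> 0 <= x + e * q) -> 0 <= x.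
Proof.
move=> x_ge; rewrite leNgt; apply/negP => x_lt0.
have q1 : 0 < 2 * (`|q| + 1) by have := normr_ge0 q; lra.
(* This [e] keeps [e * q] at most half of [- x], so the sum stays negative. *)
pose e := Num.min 1 (- x / (2 * (`|q| + 1))).
have e_gt0 : 0 < e by rewrite lt_min ltr01 divr_gt0 // oppr_gt0.
have := x_ge e e_gt0; rewrite ge_min lexx => /(_ isT).
have : e * (2 * (`|q| + 1)) <= - x by rewrite -ler_pdivlMr // ge_min lexx orbT.
by have := ler_norm q; nra.
Qed.

Section Model.
Context {R : realType} {p : nat}.
Variables (C mu : R) (Sigma : 'M[R]_p).
Hypotheses (mu_gt0 : 0 < mu) (posdef_Sigma : posdef Sigma).
Implicit Types (L S H P T Z U V W : 'M[R]_p).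

(** First variation of the squared distance: moving from [P] along a psd [Z] gives the dual cone
    condition, and shrinking [P] gives the opposite sign needed for orthogonality. This is the
    Moreau decomposition of [T]. *)
Lemma psd_projP T P : is_psd_proj T P ->
  [/\ psd P, inner (P - T) P = 0 & forall Z, psd Z -> 0 <= inner (P - T) Z].
Proof.
move=> [/= psdP minP].
have sqr_ge0 D : psd (P + D) -> 0 <= 2 * inner (P - T) D + inner D D.
  move=> /minP; rewrite lee_fin -ler_sqr ?nnegrE ?normF_ge0 // !normF_sqr.
  by rewrite !inner_linE !(innerC D) !(innerC T P); lra.
have cone Z : psd Z -> 0 <= inner (P - T) Z.
  move=> psdZ'; suff : 0 <= 2 * inner (P - T) Z by lra.
  apply: (@ge0_of_eps _ _ (inner Z Z)) => e e_gt0 _.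
  have := sqr_ge0 (e *: Z) (psdD psdP (psdZ (ltW e_gt0) psdZ')).
  rewrite !innerZl !innerZr; nra.
split=> //; apply/eqP; rewrite eq_le cone // andbT.
suff : 0 <= - (2 * inner (P - T) P) by lra.
apply: (@ge0_of_eps _ _ (inner P P)) => e e_gt0 e_le1.
(* The perturbed matrix is [P] scaled by [1 - e], psd because [e <= 1]. *)
have /sqr_ge0 : psd (P + - e *: P).
  by rewrite -{1}[P]scale1r -scalerDl; apply: psdZ; rewrite ?subr_ge0.
by rewrite !innerZl !innerZr; nra.
Qed.

Definition robj L S : R :=
  \tr L + mu * (\tr ((L + S) *m invmx Sigma) - ln (\det (L + S))).

Lemma objfE L S : posdef (L + S) -> objf mu Sigma L S = (robj L S)%:E.
Proof. by move=> pdLS; rewrite /objf; case: asboolP. Qed.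

Lemma objf_oo L S : ~ posdef (L + S) -> objf mu Sigma L S = +oo%E.
Proof. by move=> pdLS; rewrite /objf; case: asboolP. Qed.

Lemma normF2Z t L S : 0 <= t -> normF2 (t *: L) (t *: S) = t * normF2 L S.
Proof.
move=> t_ge0; rewrite /normF2 !normFZ ger0_norm // !exprMn -mulrDr.
by rewrite sqrtrM ?sqr_ge0 // sqrtr_sqr ger0_norm.
Qed.

(** The zero increment suffices: an infinite value there would make the estimate bound [+oo] by
    0. *)
Lemma is_gradient_posdef L S GL GS :
  is_gradient (objf mu Sigma) L S GL GS -> posdef (L + S).
Proof.
move=> [_ _ /(_ 1 ltr01)[d d_gt0 /(_ 0 0)]].
have sym0 : Defs.symmetric (0 : 'M[R]_p) by rewrite /Defs.symmetric trmx0.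
have norm0 : normF2 (0 : 'M[R]_p) 0 = 0.
  by have := @normF2Z 0 0 0 (lexx _); rewrite scale0r mul0r.
move=> /(_ sym0 sym0); rewrite norm0 !addr0 => /(_ (ltW d_gt0)).
have [//|npd] := pselect (posdef (L + S)).
by rewrite objf_oo //=.
Qed.

(** One short step along one ray is all that the variational arguments use. The bound [t <= e] lets
    terms quadratic in [t] join the error. *)
Lemma gradient_ray L S GL GS HL HS (e : R) :
  is_gradient (objf mu Sigma) L S GL GS ->
  Defs.symmetric HL -> Defs.symmetric HS -> 0 < e ->
  exists t : R, [/\ 0 < t, t <= e, posdef (L + t *: HL + (S + t *: HS)) &
    robj (L + t *: HL) (S + t *: HS) - robj L S <=
    t * (inner GL HL + inner GS HS + e * normF2 HL HS)].
Proof.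
move=> gradLS symHL symHS e_gt0; have pdLS := is_gradient_posdef gradLS.
have [_ _ /(_ e e_gt0)[d d_gt0 est]] := gradLS.
have n_ge0 : 0 <= normF2 HL HS by exact: sqrtr_ge0.
(* The 1 added to the norm avoids division by zero; the second argument brings the increment within
   [d]. *)
pose t := Num.min e (d / (normF2 HL HS + 1)).
have n1_gt0 : 0 < normF2 HL HS + 1 by lra.
have t_gt0 : 0 < t by rewrite lt_min e_gt0 divr_gt0.
have td : t * (normF2 HL HS + 1) <= d.
  by rewrite -ler_pdivlMr // ge_min lexx orbT.
have := est (t *: HL) (t *: HS).
rewrite /Defs.symmetric !linearZ /= symHL symHS => /(_ erefl erefl).
rewrite normF2Z ?(ltW t_gt0) // (objfE pdLS).
have le_d : t * normF2 HL HS <= d by lra.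
move=> /(_ le_d){le_d}.
have [pdt|npd] := pselect (posdef (L + t *: HL + (S + t *: HS))); last first.
  by rewrite objf_oo.
rewrite objfE // -!EFinB /= lee_fin !innerZr => est_t.
exists t; split=> //; first by rewrite ge_min lexx.
by have := le_trans (ler_norm _) est_t; lra.
Qed.

(* By concavity of [ln \det], the candidate gradient is a lower bound for the
   actual one in every direction; two linear forms so ordered are equal. *)
Lemma gradient_objf L S GL GS :
  is_gradient (objf mu Sigma) L S GL GS ->
  GL = 1%:M + mu *: (invmx Sigma - invmx (L + S)) /\
  GS = mu *: (invmx Sigma - invmx (L + S)).
Proof.
move=> gradLS; have pdLS := is_gradient_posdef gradLS.
have [symGL symGS _] := gradLS.
set N := mu *: _; set M := invmx (L + S) in N *.
have symN : Defs.symmetric N.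
  rewrite /Defs.symmetric linearZ /= linearB /= !trmx_inv.
  by rewrite pdLS.1 posdef_Sigma.1.
have lower HL HS : Defs.symmetric HL -> Defs.symmetric HS ->
    inner (1%:M + N) HL + inner N HS <= inner GL HL + inner GS HS.
  move=> symHL symHS; rewrite -subr_ge0.
  apply: (@ge0_of_eps _ _ (normF2 HL HS)) => e e_gt0 _.
  have [t [t_gt0 _ pdt]] := gradient_ray gradLS symHL symHS e_gt0.
  have := ln_det_concave pdLS pdt; rewrite -/M /robj.
  set W' := L + _ + _; set lW' := ln (\det W'); set lW := ln _.
  have -> : W' - (L + S) = t *: (HL + HS).
    by rewrite scalerDr /W' addrACA [X in X - _]addrC addrK.
  have -> : \tr (W' *m invmx Sigma) = \tr ((L + S) *m invmx Sigma) +
      t * inner (invmx Sigma) (HL + HS).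
    rewrite innerC /inner (posdef_invmx posdef_Sigma).1 -mxtraceZ scalemxAl.
    by rewrite -mxtraceD -mulmxDl scalerDr /W' addrACA.
  have -> : inner (1%:M + N) HL + inner N HS =
      \tr HL + mu * (inner (invmx Sigma) (HL + HS) - inner M (HL + HS)).
    rewrite /N !inner_linE {1}/inner mul1mx symHL; ring.
  rewrite mxtraceD mxtraceZ innerZr.
  set x := inner _ (HL + HS); set y := inner M (HL + HS).
  set n := normF2 _ _; set g := inner GL HL; set h := inner GS HS => ln_le f_le.
  have mu_ln : mu * (lW' - lW) <= mu * (t * y) by rewrite ler_pM2l.
  rewrite -(pmulr_rge0 _ t_gt0); nra.
(* Both differences are symmetric, hence legitimate directions; testing with each and its negative
   makes its squared norm vanish. *)
have symGL1 : Defs.symmetric (GL - (1%:M + N)).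
  by rewrite /Defs.symmetric linearB /= linearD /= trmx1 symGL symN.
have symGSN : Defs.symmetric (GS - N).
  by rewrite /Defs.symmetric linearB /= symGS symN.
have sym0 : Defs.symmetric (0 : 'M[R]_p) by rewrite /Defs.symmetric trmx0.
have symNN H : Defs.symmetric H -> Defs.symmetric (- H).
  by rewrite /Defs.symmetric linearN /= => ->.
split; apply/eqP; rewrite -subr_eq0; apply/eqP/inner_eq0.
  have := lower _ 0 symGL1 sym0; have := lower _ 0 (symNN _ symGL1) sym0.
  by rewrite !inner0r !addr0 !innerNr [inner (GL - _) _]innerDl innerNl; lra.
have := lower 0 _ sym0 symGSN; have := lower 0 _ sym0 (symNN _ symGSN).
by rewrite !inner0r !add0r !innerNr [inner (GS - _) _]innerDl innerNl; lra.
Qed.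

(** Comparing the minimizer with a nearby point along a symmetric direction and dividing by the step
    length gives a one-sided inequality; the opposite direction turns it into an equality. *)
Lemma argmin_stationary (rho : R) L S GL GS U Lam H : 0 < rho ->
  is_argmin [set L | Defs.symmetric L]%classic
    (fun L => objf mu Sigma L S - (inner Lam L)%:E
              + (rho / 2 * normF (L - U) ^+ 2)%:E)%E L ->
  is_gradient (objf mu Sigma) L S GL GS -> Defs.symmetric H ->
  inner (GL - Lam + rho *: (L - U)) H = 0.
Proof.
move=> rho_gt0 [/= symL minL] gradLS symH.
have pdLS := is_gradient_posdef gradLS.
have sym0 : Defs.symmetric (0 : 'M[R]_p) by rewrite /Defs.symmetric trmx0.
have lower H' : Defs.symmetric H' -> 0 <= inner (GL - Lam + rho *: (L - U)) H'.
  move=> symH'.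
  (* The remainder collects the Fréchet error and the quadratic part of the penalty, the latter
     bounded through [t <= e]. *)
  apply: (@ge0_of_eps _ _ (normF2 H' 0 + rho / 2 * normF H' ^+ 2)) => e e_gt0 _.
  have [t [t_gt0 te]] := gradient_ray gradLS symH' sym0 e_gt0.
  rewrite scaler0 addr0 => pdt ft_le.
  have := minL (L + t *: H').
  rewrite /Defs.symmetric linearD linearZ /= symL symH'.
  move=> /(_ erefl); rewrite !objfE // -!EFinB -!EFinD lee_fin.
  rewrite (addrAC L (t *: H')) !normF_sqr; move: ft_le; move: (L - U) => D.
  rewrite inner0r !inner_linE (innerC H' D) => ft_le min_le.
  have := inner_ge0 H'.
  move: ft_le min_le; move: (robj _ _) (robj L S) (normF2 _ _) => f' f n.
  move: (inner GL _) (inner Lam L) (inner Lam H') => g l l'.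
  move: (inner D H') (inner D D) (inner H' H') => d d2 h ft_le min_le h0.
  rewrite -(pmulr_rge0 _ t_gt0).
  have : rho / 2 * (t * t) * h <= rho / 2 * (t * e) * h.
    by rewrite ler_wpM2r // ler_pM2l ?divr_gt0 // ler_pM2l.
  by lra.
apply/eqP; rewrite eq_le lower // andbT -oppr_ge0 -innerNr lower //.
by rewrite /Defs.symmetric linearN /= symH.
Qed.

(** * Uniform bounds for one ADMM iteration *)

Lemma inner_invmx_le W T Z E : posdef W -> psd T -> psd Z -> W = T + Z + E ->
  inner (invmx W) T <= p%:R + normF (invmx W) * normF E.
Proof.
move=> pdW psdT psdZ defW; have psdM := posdef_psd (posdef_invmx pdW).
(* The pairing of [invmx W] with [W] is [p], and its part along [Z] is nonnegative. *)
have := inner_invmx pdW; rewrite [X in inner _ X = _]defW !innerDr.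
have := inner_psd_ge0 psdM psdZ; have := inner_ge (invmx W) E; lra.
Qed.

(** Let [n] be the norm. As the pairing with [Y] is nonnegative, stationarity gives
    [mu * n ^+ 2 <= rho * p%:R + b * n]. Dividing by [n] settles the case [1 < n]; the final 1
    covers the other. *)
Lemma normF_invmx_le (rho b : R) W Y Z :
  0 < rho -> posdef W -> psd Y -> normF Z <= b ->
  inner (Z - mu *: invmx W + rho *: (W - Y)) (invmx W) = 0 ->
  normF (invmx W) <= (rho * p%:R + b) / mu + 1.
Proof.
move=> rho_gt0 pdW psdY Zb.
rewrite !inner_linE -normF_sqr (innerC W) inner_invmx // => stat.
have YM := inner_psd_ge0 psdY (posdef_psd (posdef_invmx pdW)).
have n_ge0 := normF_ge0 (invmx W); have Z_ge0 := normF_ge0 Z.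
have ZM := inner_le Z (invmx W).
have pR_ge0 : 0 <= p%:R :> R by [].
move: YM n_ge0 ZM stat.
move: (inner Y _) (inner Z _) (normF _) (p%:R : R) pR_ge0.
move=> y z n q q_ge0 y_ge0 n_ge0 z_le stat.
have [n1|n1] := leP n 1.
  have b_ge0 := le_trans Z_ge0 Zb.
  by rewrite ler_wpDl // divr_ge0 ?(ltW mu_gt0) // addr_ge0 // mulr_ge0 // ltW.
rewrite ler_wpDr // ler_pdivlMr //.
have n_gt0 : 0 < n by lra.
rewrite -(ler_pM2r n_gt0).
have : 0 <= rho * y by rewrite mulr_ge0 // ltW.
have : 0 <= rho * q * (n - 1) by rewrite !mulr_ge0 ?subr_ge0 // ltW.
have : 0 <= (b - normF Z) * n by rewrite mulr_ge0 // subr_ge0.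
lra.
Qed.

Lemma normF_prox_l0 (gamma : R) T : normF (prox_l0 C gamma T) <= normF T.
Proof.
by apply: normF_le_entries => i j; rewrite mxE; case: ifP; rewrite ?normr0.
Qed.

(** The new multiplier is [rho] times the projection remainder, so [psd_projP] carries over. It
    serves both the [U] and the [V] updates. *)
Lemma dual_stepP (rho : R) T Lam P Lam' : 0 < rho ->
  is_psd_proj (T - rho^-1 *: Lam) P -> Lam' = Lam - rho *: (T - P) ->
  [/\ psd P, inner Lam' P = 0 & forall Z, psd Z -> 0 <= inner Lam' Z].
Proof.
move=> rho_gt0 /psd_projP[psdP orth cone] defLam'.
have {defLam'} -> : Lam' = rho *: (P - (T - rho^-1 *: Lam)).
  rewrite defLam' !scalerBr scalerA divff ?gt_eqF // scale1r.
  by rewrite !opprB addrCA.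
split=> // [|Z psdZ]; first by rewrite innerZl orth mulr0.
by rewrite innerZl mulr_ge0 ?cone // ltW.
Qed.

Lemma dual_step_diff (rho : R) T P Lam Lam' : 0 < rho ->
  Lam' = Lam - rho *: (T - P) -> T - P = rho^-1 *: (Lam - Lam').
Proof.
move=> rho_gt0 ->; rewrite opprB addrCA subrr addr0 scalerA.
by rewrite mulVf ?gt_eqF // scale1r.
Qed.

(** Three consecutive states occur because [itS A - itV A] comes from the dual increment between
    [A0] and [A], and [itL A' - itU A'] from that between [A] and [A']. The threshold [r] is uniform
    in the states, so the estimate can be iterated. *)
Lemma admm_step_bounds (rho gamma c : R) : 0 < rho -> 0 < gamma -> 0 <= c ->
  exists r : R, forall A0 A A' : admm_state R p,
    admm_step C mu Sigma rho gamma A0 A -> admm_step C mu Sigma rho gamma A A' ->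
    (forall Z, psd Z -> 0 <= inner (itTheta A0) Z) ->
    normF (itTheta A0) <= c -> normF (itTheta A) <= c ->
    normF (itLambda A) <= c -> normF (itLambda A') <= c ->
    normF (itU A') <= Num.max (normF (itU A)) r /\
    normF (itS A') <= Num.max (normF (itS A)) r.
Proof.
move=> rho_gt0 gamma_gt0 c_ge0.
have pdMs := posdef_invmx posdef_Sigma.
have pdB : posdef (1%:M + mu *: invmx Sigma).
  by apply: posdefD; [exact: posdef1 | exact: psdZ (ltW _) (posdef_psd _)].
have [lU lU_gt0 coerU] := psd_normF_le_inner pdB.
have [lS lS_gt0 coerS] := psd_normF_le_inner pdMs.
(* Here [b] bounds the bounded part of the optimality condition, [m] the norm of [M], [q] its
   pairings with [U'] and [V], and [n] the norm of the gradient [N]; [a] and [d] are the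
   coefficients of the recursion for the squared norm of [S]. *)
pose b : R := normF (1%:M + mu *: invmx Sigma) + 3 * c.
pose m : R := (rho * p%:R + b) / mu + 1.
pose q : R := p%:R + m * (4 * c / rho).
pose n : R := mu * normF (invmx Sigma) + mu * m + 3 * c.
pose d : R := 2 * gamma * (mu * lS * (2 * c / rho) + mu * q + 2 * c / rho * n)
  + gamma ^+ 2 * n ^+ 2.
pose a : R := 2 * gamma * mu * lS.
(* Above [mu * q / lU] the norm of [U'] cannot exceed that of [U]. For [S] the critical level is
   [d / a]; below it the new squared norm is at most that of [d / a] plus [d], which the square of
   [d / a + d + 1] dominates. *)
exists (Num.max (mu * q / lU) (d / a + d + 1)).
move=> A0 A A' step0 step coneT0 T0c Tc Lc L'c.
have b_ge0 : 0 <= b.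
  by have := normF_ge0 (1%:M + mu *: invmx Sigma); rewrite /b; lra.
have rp_ge0 : 0 <= rho * p%:R by rewrite mulr_ge0 // ltW.
have m_ge0 : 0 <= m.
  by rewrite addr_ge0 // divr_ge0 ?(ltW mu_gt0) // addr_ge0.
have k_ge0 k : 0 <= k%:R * c / rho by rewrite !mulr_ge0 // invr_ge0 ltW.
have q_ge0 : 0 <= q by rewrite addr_ge0 // mulr_ge0.
have n_ge0 : 0 <= n by rewrite !addr_ge0 ?mulr_ge0 ?normF_ge0 ?(ltW mu_gt0).
have a_gt0 : 0 < a by rewrite !mulr_gt0.
have d_ge0 : 0 <= d.
  have : 0 <= mu * lS * (2 * c / rho) by rewrite mulr_ge0 // ltW // mulr_gt0.
  have : 0 <= mu * q by rewrite mulr_ge0 // ltW.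
  have : 0 <= 2 * c / rho * n by rewrite mulr_ge0.
  have : 0 <= gamma ^+ 2 * n ^+ 2 by rewrite mulr_ge0 ?sqr_ge0.
  have : 0 <= 2 * gamma by lra.
  by move=> *; rewrite addr_ge0 // mulr_ge0 // !addr_ge0.
have [_ _ [projU0 projV] defL defT] := step0.
have [argL [[GL GS] /= gradLS defS'] [projU _] defL' _] := step.
have [psdV orthV _] := dual_stepP rho_gt0 projV defT.
have [psdU _ _] := dual_stepP rho_gt0 projU0 defL.
have [psdU' orthU' _] := dual_stepP rho_gt0 projU defL'.
have dV := dual_step_diff rho_gt0 defT.
have dU' := dual_step_diff rho_gt0 defL'.
have rdV : rho *: (itS A - itV A) = itTheta A0 - itTheta A.
  by rewrite dV scalerA divff ?gt_eqF // scale1r.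
have pdW := is_gradient_posdef gradLS.
have [defGL defGS] := gradient_objf gradLS.
have stat H := argmin_stationary (H := H) rho_gt0 argL gradLS.
set W := itL A' + itS A in pdW defGL defGS stat.
set M := invmx W in defGL defGS.
have pdM : posdef M := posdef_invmx pdW.
have psdUV := psdD psdU psdV.
(* Stationarity contains [L' - U] only; adding and subtracting the bounded dual increment
   [rho *: (S - V)] completes it to [W - (U + V)]. *)
have Mm : normF M <= m.
  apply: (@normF_invmx_le rho b _ (itU A + itV A)
    (1%:M + mu *: invmx Sigma - itLambda A - (itTheta A0 - itTheta A))) => //.
    rewrite /b; apply: le_trans (normFB _ _) _.
    apply: le_trans (lerD (normFB _ _) (normFB _ _)) _.
    by lra.
  have := stat M pdM.1; have := congr1 (inner^~ M) rdV.
  by rewrite defGL /W /= !inner_linE; lra.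
have defW : W = itU A' + itV A + (rho^-1 *: (itLambda A - itLambda A') +
    rho^-1 *: (itTheta A0 - itTheta A)).
  rewrite -dV -dU' /W addrACA [_ + (_ - _)]addrC subrK.
  by rewrite [_ + (_ - _)]addrC subrK.
have Ec : normF (rho^-1 *: (itLambda A - itLambda A') +
    rho^-1 *: (itTheta A0 - itTheta A)) <= 4 * c / rho.
  rewrite -scalerDr normFZ ger0_norm ?invr_ge0 ?(ltW rho_gt0) // mulrC.
  rewrite ler_pM2r ?invr_gt0 //.
  apply: le_trans (normFD _ _) _.
  apply: le_trans (lerD (normFB _ _) (normFB _ _)) _.
  by lra.
have MEq : p%:R + normF M * normF (rho^-1 *: (itLambda A - itLambda A') +
    rho^-1 *: (itTheta A0 - itTheta A)) <= q.
  by rewrite lerD2l ler_pM ?normF_ge0.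
have MU'q := le_trans (inner_invmx_le pdW psdU' psdV defW) MEq.
have MVq : inner M (itV A) <= q.
  apply: le_trans (inner_invmx_le pdW psdV psdU' _) MEq.
  by rewrite (addrC (itV A)).
split.
  have [small|large] := leP (normF (itU A')) (mu * q / lU).
    by rewrite !le_max small !orbT.
  rewrite le_max; apply/orP; left.
  have u'_gt0 : 0 < normF (itU A').
    by apply: le_lt_trans large; rewrite divr_ge0 ?mulr_ge0 // ltW.
  rewrite -(ler_pM2r u'_gt0); apply: le_trans (inner_le _ _).
  rewrite -expr2 normF_sqr -subr_le0 -(pmulr_rle0 _ rho_gt0).
  move: large; rewrite ltr_pdivrMr // => large.
  have muMU : mu * inner M (itU A') <= mu * q by rewrite ler_pM2l.
  (* Orthogonality of the new multiplier to [U'] replaces [L'] by [U'] in the stationarity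
     condition. *)
  have := coerU _ psdU'; have := stat _ psdU'.1.
  have := orthU'; rewrite defL' defGL !inner_linE; lra.
pose N := GS - itTheta A + rho *: (itS A - itV A).
have defN : N = mu *: (invmx Sigma - M) - itTheta A + (itTheta A0 - itTheta A).
  by rewrite /N defGS rdV.
have S'N : normF (itS A') <= normF (itS A - gamma *: N).
  by rewrite defS' normF_prox_l0.
clearbody N.
have Nn : normF N <= n.
  rewrite defN; apply: le_trans (normFD _ _) _.
  apply: le_trans (lerD (normFB _ _) (normFB _ _)) _.
  rewrite normFZ gtr0_norm //.
  have : mu * normF (invmx Sigma - M) <= mu * (normF (invmx Sigma) + m).
    by rewrite ler_pM2l //; apply: le_trans (normFB _ _) _; rewrite lerD2l.
  by rewrite /n; lra.
have SVc : normF (itS A - itV A) <= 2 * c / rho.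
  rewrite dV normFZ ger0_norm ?invr_ge0 ?(ltW rho_gt0) // mulrC.
  rewrite ler_pM2r ?invr_gt0 //; apply: le_trans (normFB _ _) _; lra.
have SVN : - (2 * c / rho * n) <= inner (itS A - itV A) N.
  by apply: le_trans (inner_ge _ _); rewrite lerN2 ler_pM ?normF_ge0.
have Sv : normF (itS A) <= normF (itV A) + 2 * c / rho.
  by have := normFD (itS A - itV A) (itV A); rewrite subrK; lra.
(* Both copies of [itTheta A] in [N] vanish against [itV A], and [itTheta A0] pairs nonnegatively
   with it. *)
have VN : mu * lS * normF (itV A) - mu * q <= inner (itV A) N.
  have : mu * (lS * normF (itV A)) <= mu * inner (invmx Sigma) (itV A).
    by rewrite ler_pM2l // coerS.
  have : mu * inner M (itV A) <= mu * q by rewrite ler_pM2l.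
  have := coneT0 _ psdV; have := orthV.
  by rewrite (innerC (itV A)) defN !inner_linE; lra.
(* Coercivity holds for the psd matrix [itV A]; it passes to [itS A], which lies within
   [2 * c / rho] of it. *)
have SN : mu * lS * normF (itS A) - (mu * lS * (2 * c / rho) + mu * q +
    2 * c / rho * n) <= inner (itS A) N.
  have : mu * lS * normF (itS A) <= mu * lS * (normF (itV A) + 2 * c / rho).
    by rewrite ler_pM2l // mulr_gt0.
  by move: SVN VN; rewrite innerDl innerNl; lra.
have S'_sqr : normF (itS A') ^+ 2 <= normF (itS A) ^+ 2 - a * normF (itS A) + d.
  move: S'N; rewrite -ler_sqr ?nnegrE ?normF_ge0 // => /le_trans; apply.
  rewrite !normF_sqr !inner_linE (innerC N) -!normF_sqr.
  have : gamma ^+ 2 * normF N ^+ 2 <= gamma ^+ 2 * n ^+ 2.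
    by rewrite ler_pM2l ?exprn_gt0 // ler_sqr ?nnegrE ?normF_ge0.
  have : gamma * (mu * lS * normF (itS A) - (mu * lS * (2 * c / rho) + mu * q +
    2 * c / rho * n)) <= gamma * inner (itS A) N by rewrite ler_pM2l.
  rewrite /a /d; move: (inner _ N) (normF N) (normF _) => sn nn s.
  clear; lra.
clearbody a d.
have [large|small] := leP (d / a) (normF (itS A)).
  rewrite le_max; apply/orP; left; rewrite -ler_sqr ?nnegrE ?normF_ge0 //.
  move: large; rewrite ler_pdivrMr // => large.
  by apply: le_trans S'_sqr _; lra.
rewrite !le_max; apply/orP; right; apply/orP; right.
have da_ge0 : 0 <= d / a by rewrite divr_ge0 // ltW.
have da1_ge0 : 0 <= d / a + d + 1 by rewrite !addr_ge0.
rewrite -ler_sqr ?nnegrE ?normF_ge0 //; apply: le_trans S'_sqr _.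
have : 0 <= a * normF (itS A) by rewrite mulr_ge0 ?normF_ge0 // ltW.
have : normF (itS A) ^+ 2 <= (d / a) ^+ 2.
  by rewrite ler_sqr ?nnegrE ?normF_ge0 // ltW.
have : 0 <= d / a * d by rewrite mulr_ge0.
have := sqr_ge0 d.
by move: (d / a) da_ge0 => x; nra.
Qed.

End Model.

(** * Bounded sequences and the boundedness of the iterates *)

Section Bounded.
Context {R : realType} {p : nat}.
Implicit Types X Y Z : nat -> 'M[R]_p.

Lemma bounded_seq_shift X : bounded_seq (fun k => X k.+1) -> bounded_seq X.
Proof.
move=> [c Xc]; exists (Num.max c (normF (X 0))) => -[|k].
  by rewrite le_max lexx orbT.
by rewrite le_max Xc.
Qed.

Lemma bounded_seq_max X (r : R) :
  (forall k, normF (X k.+1) <= Num.max (normF (X k)) r) -> bounded_seq X.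
Proof.
move=> leX; exists (Num.max (normF (X 0)) r); elim=> [|k IHk].
  by rewrite le_max lexx.
by rewrite (le_trans (leX k)) // ge_max IHk le_max lexx orbT.
Qed.

Lemma bounded_seqD X Y : bounded_seq X -> bounded_seq Y ->
  bounded_seq (fun k => X k + Y k).
Proof.
move=> [c Xc] [d Yd]; exists (c + d) => k.
by rewrite (le_trans (normFD _ _)) // lerD.
Qed.

Lemma bounded_seqZ (a : R) X : bounded_seq X -> bounded_seq (fun k => a *: X k).
Proof.
by move=> [c Xc]; exists (`|a| * c) => k; rewrite normFZ ler_wpM2l.
Qed.

Lemma bounded_seqB X Y : bounded_seq X -> bounded_seq Y ->
  bounded_seq (fun k => X k - Y k).
Proof.
move=> bX bY; under eq_fun do rewrite -scaleN1r.
exact/bounded_seqD/bounded_seqZ.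
Qed.

End Bounded.

Theorem proposition4 (R : realType) (p : nat) (hp : (0 < p)%N)
    (C mu : R) (hC : 0 < C) (hmu : 0 < mu)
    (Sigma : 'M[R]_p) (hSigma : posdef Sigma)
    (Lbar Sbar : 'M[R]_p) (hbar : domD Lbar Sbar)
    (K : R) (hK : 0 < K)
    (hlip : grad_lipschitz_on mu Sigma
              (sublevel C mu Sigma (objF C mu Sigma Lbar Sbar)) K) :
  exists2 rho0 : R, 0 < rho0 &
    forall rho gamma : R, rho0 < rho -> 0 < gamma -> gamma <= 1 / (K + 2 * rho) ->
    forall A : nat -> admm_state R p,
      is_admm_sequence C mu Sigma rho gamma A ->
      dual_bounded A -> admm_bounded A.
Proof.
exists 1 => // rho gamma rho_gt1 gamma_gt0 _ A [_ step] bdual.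
have rho_gt0 : 0 < rho := lt_trans ltr01 rho_gt1.
have [bL bT] := bdual; have [[cL Lc] [cT Tc]] := bdual.
pose c := Num.max 0 (Num.max cL cT).
have [|r bound] := admm_step_bounds C hmu hSigma rho_gt0 gamma_gt0 (_ : 0 <= c).
  by rewrite le_max lexx.
(* The cone condition on the first of the three states comes from the step before it, so the
   recursion starts at index 2; the first two terms are restored by [bounded_seq_shift]. *)
have {}bound k : normF (itU (A k.+3)) <= Num.max (normF (itU (A k.+2))) r /\
    normF (itS (A k.+3)) <= Num.max (normF (itS (A k.+2))) r.
  have [_ _ [_ projV] _ defT] := step k.
  have [_ _ coneT] := dual_stepP rho_gt0 projV defT.
  by apply: (bound _ _ _ (step k.+1) (step k.+2) coneT);
    rewrite !le_max ?Lc ?Tc ?orbT.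
have bU : bounded_seq (fun k => itU (A k)).
  do 2!apply: bounded_seq_shift.
  by apply: bounded_seq_max => k; exact: (bound k).1.
have bS : bounded_seq (fun k => itS (A k)).
  do 2!apply: bounded_seq_shift.
  by apply: bounded_seq_max => k; exact: (bound k).2.
have shift (X : nat -> 'M[R]_p) : bounded_seq X -> bounded_seq (fun k => X k.+1).
  by move=> [d Xd]; exists d => k.
(* The remaining [L] and [V] differ from [U] and [S] by dual increments scaled by [rho^-1]. *)
split=> //; apply: bounded_seq_shift.
  have [d bd] := bounded_seqD (shift _ bU)
    (bounded_seqZ rho^-1 (bounded_seqB bL (shift _ bL))).
  exists d => k; rewrite -[itL _](subrK (itU (A k.+1))) addrC.
  by have [_ _ _ /(dual_step_diff rho_gt0)-> _] := step k.
have [d bd] := bounded_seqB (shift _ bS)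
  (bounded_seqZ rho^-1 (bounded_seqB bT (shift _ bT))).
exists d => k; rewrite -[itV _](subKr (itS (A k.+1))).
by have [_ _ _ _ /(dual_step_diff rho_gt0)->] := step k.
Qed.
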